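(* Let $Y$ be a Tychonoff space. If $Y$ is countably 1-paracompact in every Tychonoff space $X$ that contains $Y$ as a closed subspace, then $Y$ is linearly Lindelöf.
   Context: A subspace $Y \subset X$ of a topological space $X$ is called countably 1-paracompact in $X$ if for every countable open cover $\mathcal{U}$ of $X$ there is an open cover $\mathcal{V}$ of $X$ which refines $\mathcal{U}$ (every element of $\mathcal{V}$ is contained in some element of $\mathcal{U}$) and is locally finite at the points of $Y$, i.e. every point of $Y$ has a neighbourhood in $X$ that meets only finitely many elements of $\mathcal{V}$. A space $Y$ is linearly Lindelöf if every uncountable subset $Z \subset Y$ whose cardinality is a regular cardinal has a complete accumulation point in $Y$, i.e. a point $y \in Y$ such that $|U \cap Z| = |Z|$ for every neighbourhood $U$ of $y$ in $Y$. A space $X$ ''contains $Y$ as a closed subspace'' means that $Y$ is (homeomorphic to, and identified with) a closed subset of $X$ with the subspace topology. *)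

(* Defs.v *)
From HB Require Import structures.
From mathcomp Require Import all_boot all_order all_algebra.
From mathcomp Require Import all_classical wochoice.
From mathcomp Require Import topology normedtype.

Set Implicit Arguments.
Unset Strict Implicit.
Unset Printing Implicit Defensive.

Local Open Scope classical_set_scope.
Local Open Scope card_scope.

(* [completely_regular_space] is phrased with [uniform_separator]; by
   [uniform_separatorP] this is separation of a point from a closed set by a
   continuous function into [0, 1]. [accessible_space] is T1. *)
Definition tychonoff_space (X : topologicalType) : Prop :=
  accessible_space X /\ completely_regular_space X.

Definition closed_embedding (Y X : topologicalType) (i : Y -> X) : Prop :=
  [/\ injective i,
      @open Y = [set i @^-1` B | B in @open X] &
      closed (range i)].

Definition open_cover (X : topologicalType) (U : set (set X)) : Prop :=
  U `<=` open /\ \bigcup_(u in U) u = [set: X].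

Definition refines (X : Type) (V U : set (set X)) : Prop :=
  forall v, V v -> exists2 u, U u & v `<=` u.

Definition locally_finite_at (X : topologicalType) (V : set (set X)) (x : X) :
    Prop :=
  exists2 N, nbhs x N & finite_set [set v | V v /\ N `&` v !=set0].

Definition countably_1_paracompact (X : topologicalType) (A : set X) : Prop :=
  forall U : set (set X), countable U -> open_cover U ->
    exists V : set (set X), [/\ open_cover V, refines V U &
      forall x, A x -> locally_finite_at V x].

(* [R] is a (reflexive) well-order of [Z] whose order type is the initial
   ordinal |Z|: every proper initial segment has cardinality < |Z|. *)
Definition initial_well_order (T : Type) (Z : set T) (R : rel T) : Prop :=
  wo_chain R [pred x | x \in Z] /\
  forall z, Z z -> ~ (Z #<= [set x | [/\ Z x, R x z & x <> z]]).

Definition cofinal_in (T : Type) (Z : set T) (R : rel T) (C : set T) : Prop :=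
  C `<=` Z /\ forall z, Z z -> exists2 c, C c & R z c.

(* |Z| is infinite and equal to its own cofinality. Initial well-orders of [Z]
   exist and are pairwise isomorphic, so the choice of [R] is immaterial. *)
Definition regular_cardinality (T : Type) (Z : set T) : Prop :=
  infinite_set Z /\
  exists2 R : rel T, initial_well_order Z R &
    forall C : set T, cofinal_in Z R C -> C #= Z.

Definition complete_accumulation_point (Y : topologicalType) (Z : set Y)
    (y : Y) : Prop :=
  forall U : set Y, nbhs y U -> U `&` Z #= Z.

Definition linearly_lindelof (Y : topologicalType) : Prop :=
  forall Z : set Y, ~ countable Z -> regular_cardinality Z ->
    exists y : Y, complete_accumulation_point Z y.

(* Main.v *)
(* Suppose [Z] in [Y] has uncountable regular cardinality and no complete
   accumulation point, and embed [Y] in a compact cube [C]. The complete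
   accumulation points of [Z] in [C] form a closed set [K] disjoint from [Y].
   In the plank [X = Y x {0} U C x {1/(n+1) : n}], with [Y x {0}] closed, take
   the countable open cover by the levels [X_n = C x {1/(n+1)}] and by the
   complement of the union of the [K x {1/(n+1)}]. In a refinement [V], the
   members meeting [K x {1/(n+1)}] lie in [X_n] and cover [W_n x {1/(n+1)}] for
   some open [W_n] containing [K]; by compactness [Z \ W_n] is a finite union of
   sets of cardinality < |Z|. As |Z| is regular and uncountable, some [z] in [Z]
   lies in every [W_n], and then every neighbourhood of [(z, 0)] meets members
   of [V] inside infinitely many levels. *)
From HB Require Import structures.
Require Import Defs.
From mathcomp Require Import all_boot all_order all_algebra finmap.
From mathcomp Require Import all_classical wochoice reals.
From mathcomp Require Import topology normedtype sequences.
From mathcomp Require Import Rstruct.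
Import Order.TTheory GRing.Theory Num.Theory numFieldNormedType.Exports.
Local Open Scope classical_set_scope.
Local Open Scope card_scope.

(* If every [A i `&` Z] is smaller than [Z], each of them has a strict upper
   bound in [Z]; these countably many bounds are bounded by some [z] in [Z],
   which then lies in no [A i]. *)
Lemma regular_countable_cover {I} {T : choiceType} (Z : set T) (D : set I)
    (A : I -> set T) :
  ~ countable Z -> regular_cardinality Z -> countable D ->
  Z `<=` \bigcup_(i in D) A i -> exists2 i, D i & A i `&` Z #= Z.
Proof.
move=> Zunc [Zinf [R [Rwo _] Zreg]] Dcnt ZA; apply: contrapT => small.
have /choice[g gP] i : exists z, D i ->
    Z z /\ forall c, A i c -> Z c -> ~ R z c.
  have [Di|] := pselect (D i); last first.
    by have [z _] := infinite_setN0 Zinf; exists z.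
  have /not_andP[[]|] : ~ cofinal_in Z R (A i `&` Z).
    by move=> /Zreg AZ; apply: small; exists i.
    by move=> ? [].
  move=> /existsNP[z /not_implyP[Zz zP]]; exists z => _; split=> // c Ac Zc Rzc.
  by apply: zP; exists c.
have gZ : g @` D `<=` Z by move=> _ [i Di <-]; case: (gP i Di).
have /not_andP[//|/existsNP[z /not_implyP[Zz zP]]] : ~ cofinal_in Z R (g @` D).
  move=> /Zreg/card_eqPle[_ /sub_countable Zc]; apply: Zunc; apply: Zc.
  exact: card_le_trans (card_image_le _ _) Dcnt.
have [i Di Aiz] := ZA z Zz; have [Zg /(_ z Aiz Zz) Rgz] := gP i Di.
have /wo_chainW/(_ z _ (mem_set Zz) (mem_set Zg))/orP[Rzg|//] := Rwo.
by apply: zP; exists (g i) => //; exists i.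
Qed.

Local Open Scope ring_scope.

(** Evaluation at all continuous functions into $[0,1]$ is an embedding, because complete regularity
    makes this family separate points from closed sets; the cube is compact by Tychonoff's
    theorem. *)
Lemma tychonoff_cube_embedding (R : realType) (Y : topologicalType) :
  tychonoff_space Y -> exists (P : uniformType) (e : Y -> P) (C : set P),
  [/\ accessible_space P, compact C, range e `<=` C, injective e &
      @open Y = [set e @^-1` B | B in @open P]].
Proof.
move=> [Yacc Ycr].
pose F := [set f : Y -> R | continuous f /\ range f `<=` `[0, 1]].
pose f_ (f : F) : Y -> R := \val f.
have sepf : separate_points_from_closed f_.
  move=> B y Bcl By.
  have /(@uniform_separatorP _ R)[f [fc f01 fy fB]] := Ycr y B Bcl By.
  have Ff : f \in F by rewrite inE.
  exists (SigSub Ff) => /=.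
  (* [f] is 1 on [B], so the closure of its image stays in the closed set {1}, while [f y] is 0. *)
  have /closure_id e1 : closed [set (1 : R)].
    exact: accessible_closed_set1 (hausdorff_accessible (@Rhausdorff R)) _.
  move=> /(closure_subset fB); rewrite -e1 /f_ /= => f1.
  have := fy (f y) (ex_intro2 _ _ y erefl erefl).
  by rewrite /= f1 => /eqP; rewrite oner_eq0.
have ctsf i : continuous (f_ i) by have /set_mem[] := valP i.
have einj := join_product_inj sepf Yacc.
exists ({ptws F -> R} : uniformType), (join_product f_),
  [set f | forall i, `[0, 1]%classic (f i)]; split.
- exact/hausdorff_accessible/hausdorff_product.
- exact: (@tychonoff _ (fun=> R) (fun=> `[0, 1]%classic)
    (fun=> @segment_compact R 0 1)).
- by move=> _ [y _ <-] i /=; have /set_mem[_] := valP i; apply; exists y.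
- by move=> x y; apply: einj; rewrite inE.
- exact: (join_product_initial sepf ctsf einj).
Qed.

Lemma accessible_prod (P Q : topologicalType) :
  accessible_space P -> accessible_space Q -> accessible_space (P * Q)%type.
Proof.
move=> Pacc Qacc [x1 x2] [y1 y2]; rewrite xpair_eqE negb_and.
move=> /orP[/Pacc|/Qacc].
- move=> [A [oA]]; rewrite !inE => Ax Ay.
  exists (fst @^-1` A); rewrite !inE; split=> //.
  by apply: open_comp => // -[p q] _; exact: cvg_fst.
- move=> [A [oA]]; rewrite !inE => Ax Ay.
  exists (snd @^-1` A); rewrite !inE; split=> //.
  by apply: open_comp => // -[p q] _; exact: cvg_snd.
Qed.

(** A subspace inherits the uniformity of [P], and uniform spaces are completely regular; T1 is
    pulled back along the injection [\val]. *)
Lemma tychonoff_set_type (R : realType) (P : uniformType) (A : set P) :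
  accessible_space P -> tychonoff_space A.
Proof.
move=> Pacc; split; last exact: (@uniform_completely_regular R).
move=> x y xy; have /Pacc[B [oB Bx By]] : \val x != \val y.
  by apply: contra_neq xy; exact: val_inj.
exists (set_val @^-1` B); rewrite !inE in Bx By *.
by split; first exists B.
Qed.

(* [compact_cover] requires a pointed type. *)
Lemma compact_cover_compact (T : topologicalType) (K : set T) :
  compact K -> cover_compact K.
Proof.
have [->|/set0P[x0 _]] := eqVneq K set0.
  by move=> _ I D f _ _; exists fset0%fset.
pose T' := HB.pack_for ptopologicalType T (isPointed.Build T x0).
by move=> Kco; have : @compact T' K := Kco; rewrite compact_cover.
Qed.

Lemma compact_finite_subcover (T : topologicalType) (K : set T)
    (S : set (set T)) :
  compact K -> S `<=` open -> K `<=` \bigcup_(B in S) B ->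
  exists D, [/\ finite_set D, D `<=` S & K `<=` \bigcup_(B in D) B].
Proof.
move=> /compact_cover_compact Kco Sop KS.
have [D DS KD] := Kco _ S id Sop KS.
have Dfin := @finite_fset _ D; exists [set` D]; split=> //.
by move=> B /= /DS /set_mem.
Qed.

Lemma harmonic_isolated (R : realType) (n : nat) :
  exists O : set R, [/\ open O, ~ O 0 & forall m, O m.+1%:R^-1 <-> m = n].
Proof.
(* This is the interval from 1/(n+2) to 1/n; the product form of the upper bound imposes nothing
   when [n] is 0. *)
exists ([set r | n.+2%:R^-1 < r] `&` [set r | r * n%:R < 1]); split.
- apply: openI; first exact: open_gt.
  apply: (@open_comp _ _ (fun r : R => r * n%:R) [set r | r < 1]).
    by move=> r _; exact: mulrr_continuous.
  exact: open_lt.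
- by case=> /=; rewrite ltNge invr_ge0 ler0n.
- move=> m /=; rewrite ltf_pV2 ?posrE ?ltr0n// ltr_nat ltnS.
  rewrite mulrC ltr_pdivrMr ?ltr0n// mul1r ltr_nat ltnS.
  by split=> [[mn nm]|->//]; apply/eqP; rewrite eqn_leq; apply/andP.
Qed.

Section plank.
Context {R : realType} {Y : topologicalType} {P : uniformType}.
Variables (e : Y -> P) (C : set P).
Hypotheses (einj : injective e) (eC : range e `<=` C).
Hypothesis (eop : @open Y = [set e @^-1` B | B in @open P]).

(** Carved out of the uniform space [P * R], so that it is Tychonoff as a subspace. *)
Definition plank : set (P * R) :=
  [set p | (p.2 = 0 /\ range e p.1) \/ C p.1 /\ exists n, p.2 = n.+1%:R^-1].

Definition plank_edge (y : Y) : plank :=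
  SigSub (mem_set (or_introl (conj erefl (imageT e y))) : (e y, 0) \in plank).

Definition plank_slice n c (Cc : C c) : plank :=
  SigSub (mem_set (or_intror (conj Cc (ex_intro _ n erefl))) :
    (c, n.+1%:R^-1) \in plank).

Let econt : continuous e.
Proof. by apply/continuousP => B oB; rewrite eop; exists B. Qed.

Lemma plank_edge_closed_embedding : closed_embedding plank_edge.
Proof.
split.
- by move=> x y /(congr1 \val) [/einj].
- rewrite eqEsubset; split=> [U|_ [_ [O oO <-] <-]].
    rewrite eop => -[B oB <-]; exists (\val @^-1` (fst @^-1` B)) => //.
    exists (fst @^-1` B) => //.
    by apply: open_comp => // -[p q] _; exact: cvg_fst.
  rewrite -/(open _) -[X in open X]/((fun y => (e y, 0 : R)) @^-1` O).
  by apply: open_comp => // y _; exact: (cvg_pair (econt y) (cvg_cst _)).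
(* The edge is the zero set of the height, since no 1/(n+1) vanishes. *)
- have -> : range plank_edge = \val @^-1` (snd @^-1` [set 0 : R]).
    rewrite eqEsubset; split=> [_ [y _ <-] //|[[p r] pr] /= r0].
    have [[_ [y _ /= yp]]|[_ [n /= rn]]] := set_mem pr.
      by exists y => //; apply: val_inj; rewrite /= yp -r0.
    by exfalso; move/eqP: r0; rewrite rn invr_eq0 pnatr_eq0.
  apply: closed_comp => [x _|];
    first exact: (@initial_continuous _ (P * R)%type).
  apply: closed_comp => [[p r] _|]; first exact: cvg_snd.
  exact: accessible_closed_set1 (hausdorff_accessible (@Rhausdorff R)) _.
Qed.

Lemma paracompact_plank_linearly_lindelof :
  compact C -> countably_1_paracompact (range plank_edge) ->
  linearly_lindelof Y.
Proof.
move=> Cco para Z Zunc Zreg; apply: contrapT => nocap.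
pose S := [set B : set P | open B /\ ~ (e @^-1` B `&` Z #= Z)].
(* [~` G] plays the role of [K]. *)
pose G := \bigcup_(B in S) B.
have oG : open G by apply: bigcup_open => B [].
have eG y : G (e y).
  have /existsNP[U /not_implyP[yU UZ]] : ~ complete_accumulation_point Z y.
    by move=> yZ; apply: nocap; exists y.
  move: yU; rewrite nbhsE => -[U0 [oU0 yU0] U0U].
  move: oU0; rewrite eop => -[B oB BU0]; rewrite -BU0 in yU0 U0U.
  exists B => //; split=> // /card_eqPle[_ ZB].
  apply: UZ; apply/card_eqPle; split.
    exact: subset_card_le (@subIsetr _ _ _).
  by apply: card_le_trans ZB (subset_card_le _) => z [/U0U].
have /choice[O OP] := @harmonic_isolated R.
pose U_ n : set plank := \val @^-1` (snd @^-1` O n).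
pose U' : set plank := \val @^-1` (fst @^-1` G).
(* Index 0 carries the set containing the whole edge; level [k] has index [k.+1]. *)
pose cov n := if n is k.+1 then U_ k else U'.
have [||V [[Vop Vcov] VU Vfin]] := para (range cov).
- exact: card_image_le.
- split=> [B [[|n] _ <-]|].
  + exists (fst @^-1` G) => //.
    by apply: open_comp => // -[p q] _; exact: cvg_fst.
  + have [oO _ _] := OP n.
    exists (snd @^-1` O n) => //.
    by apply: open_comp => // -[p q] _; exact: cvg_snd.
  + apply/seteqP; split=> // -[p pp] _.
    have [[_ [y _ yp]]|[_ [n pn]]] := set_mem pp.
      by exists U'; [exists 0|rewrite /U'/= -yp].
    exists (U_ n); first by exists n.+1.
    by rewrite /U_/= pn; have [_ _ ->] := OP n.
pose W n := \bigcup_(B in [set B | [/\ open B, V (\val @^-1` B) &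
    exists c, [/\ C c, ~ G c & B (c, n.+1%:R^-1)]]])
  (fun c => (c, n.+1%:R^-1)) @^-1` B.
have oW n : open (W n).
  apply: bigcup_open => B [oB _ _]; apply: open_comp => // c _.
  exact: (cvg_pair (@cvg_id _ _) (cvg_cst _)).
(* A point of [K] at level [n] lies in some member of [V], which then counts towards [W n]. *)
have CW n : C `\` W n `<=` G.
  move=> c [Cc Wc]; apply: contrapT => Gc; apply: Wc.
  have [v Vv vc] : (\bigcup_(u in V) u) (plank_slice n c Cc) by rewrite Vcov.
  have [B oB Bv] := Vop v Vv; rewrite -Bv in Vv vc.
  by exists B => //; split=> //; exists c.
have /choice[D DP] n : exists D,
    [/\ finite_set D, D `<=` S & C `\` W n `<=` \bigcup_(B in D) B].
  apply: compact_finite_subcover => //; last by move=> B [].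
  rewrite setDE; apply: compact_closedI => //; exact: open_closedC.
have [z Zz zW] : exists2 z, Z z & forall n, W n (e z).
  apply: contrapT => noz.
  have [||B [n _ DB]] := @regular_countable_cover _ _ Z (\bigcup_n D n)
      (fun B => e @^-1` B) Zunc Zreg.
  - apply: bigcup_countable => // n _.
    by apply: finite_set_countable; case: (DP n).
  - move=> z Zz; have /existsNP[n zn] : ~ forall n, W n (e z).
      by move=> ?; apply: noz; exists z.
    have [_ _ /(_ (e z))[]] := DP n; first by split=> //; apply: eC; exists z.
    by move=> B DB Bz; exists B => //; exists n.
  by have [_ DS _] := DP n; case: (DS B DB).
pose zs n := plank_slice n (e z) (eC _ (imageT e z)).
(* A member with a point of [K] at level [n] is not inside [U'], so it is inside some [U_ k]; the
   height of that point forces [k = n]. *)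
have /choice[v vP] n : exists v, [/\ V v, v (zs n) & v `<=` U_ n].
  have [B [oB VB [c [Cc Gc Bc]]] Bz] := zW n; exists (\val @^-1` B).
  split=> //; have [u [[|k] _ <-] vu] := VU _ VB.
    by have := vu (plank_slice n c Cc) Bc.
  have [_ _ Ok] := OP k.
  by have /Ok -> := vu (plank_slice n c Cc) Bc.
have [N zN Nfin] := Vfin (plank_edge z) (imageT _ _).
have [m mN] : exists m, forall n, N (zs (m + n)%N).
  have [_ [[B oB <-] /= Bz] BN] := zN.
  have : (e z, n.+1%:R^-1 : R) @[n --> \oo] --> (e z, 0 : R).
    exact: (cvg_pair (cvg_cst _) cvg_harmonic).
  move=> /(_ B (open_nbhs_nbhs (conj oB Bz)))[m _ mB].
  by exists m => n; apply: BN; apply: mB; rewrite /= leq_addr.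
(* [v l] lies in level [l] only, whereas [v k] contains a point of level [k]. *)
have vinj : injective v.
  move=> k l kl; have [_ vk _] := vP k; have [_ _ vl] := vP l.
  move: vk; rewrite kl => /vl.
  by have [_ _ Ol] := OP l; move=> /Ol.
(* The indices whose member meets [N] would be finite in number by injectivity, yet every index
   qualifies. *)
apply: infinite_nat; have := finite_preimage (f := fun n => v (m + n)%N) _ Nfin.
set F := (X in finite_set X); have -> : F = setT.
  apply/seteqP; split=> // n _; have [Vv vz _] := vP (m + n)%N.
  by split=> //; exists (zs (m + n)%N).
by apply=> i j _ _ /vinj/addnI.
Qed.

End plank.

Theorem theorem1 (Y : topologicalType) (hY : tychonoff_space Y)
    (hpara : forall (X : topologicalType) (i : Y -> X),
       tychonoff_space X -> closed_embedding i ->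
       countably_1_paracompact (range i)) :
  linearly_lindelof Y.
Proof.
(* The statement mentions no real field, so a concrete one is fixed here. *)
pose R : realType := Rdefinitions.R.
have [P [e [C [Pacc Cco eC einj eop]]]] := @tychonoff_cube_embedding R Y hY.
apply: (@paracompact_plank_linearly_lindelof R Y P e C eC eop Cco).
apply: hpara; last exact: plank_edge_closed_embedding.
apply: (tychonoff_set_type R); apply: accessible_prod => //.
exact: (hausdorff_accessible (@Rhausdorff R)).
Qed.
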